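(* Let $f\colon\mathbb{D}\to\mathbb{D}$ be holomorphic and let $h\colon\mathbb{D}\to\mathbb{D}$ be a left straightening of $\{f^n\}$. Then for every $z,w\in\mathbb{D}$ we have $$\lim_{n\to+\infty}\omega\bigl(f^n(z),f^n(w)\bigr)=\omega\bigl(h(z),h(w)\bigr).$$ In particular, $s^f(z)=\omega\bigl(h(z),h(f(z))\bigr)$ for every $z\in\mathbb{D}$.
   Context: $\mathbb{D}=\{z\in\mathbb{C} : |z|<1\}$; $\mathrm{Aut}(\mathbb{D})$ is the group of biholomorphic self-maps of $\mathbb{D}$; $f^n$ is the $n$-th iterate of $f$. The Poincaré distance on $\mathbb{D}$ is $\omega(z_1,z_2)=\tanh^{-1}\left|\frac{z_2-z_1}{1-\overline{z_1}z_2}\right|$, where $\tanh^{-1}t=\frac12\log\frac{1+t}{1-t}$. A left straightening of the sequence of iterates $\{f^n\}$ is a holomorphic map $h\colon\mathbb{D}\to\mathbb{D}$ for which there is a sequence $\{\gamma_n\}\subset\mathrm{Aut}(\mathbb{D})$ such that $\gamma_n^{-1}\circ f^n\to h$ uniformly on compact subsets of $\mathbb{D}$. The hyperbolic step of $f$ is the function $s^f\colon\mathbb{D}\to[0,+\infty)$, $s^f(z)=\lim_{n\to+\infty}\omega\bigl(f^n(z),f^{n+1}(z)\bigr)$; the limit exists because, by the Schwarz-Pick theorem, the sequence is non-increasing. *)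

(* Defs.v *)
(* Stdlib reals with Coquelicot's complex numbers. *)
From Stdlib Require Import Reals List.
From Coquelicot Require Import Coquelicot.

Open Scope R_scope.

Definition unit_disc (z : C) : Prop := Cmod z < 1.

(* A map D -> D is represented by a total function C -> C of which only the
   values on D matter.  As D is open, differentiability at a point of D
   depends only on the values on D. *)
Definition holomorphic_on (D : C -> Prop) (f : C -> C) : Prop :=
  forall z : C, D z -> @ex_derive C_AbsRing C_NormedModule f z.

Definition holomorphic_self_map (f : C -> C) : Prop :=
  (forall z : C, unit_disc z -> unit_disc (f z)) /\ holomorphic_on unit_disc f.

(* [g] is the compositional inverse of [f] on the disc only. *)
Definition inverse_on_disc (f g : C -> C) : Prop :=
  forall z : C, unit_disc z -> g (f z) = z /\ f (g z) = z.

Definition is_disc_inverse (gamma delta : C -> C) : Prop :=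
  holomorphic_self_map delta /\ inverse_on_disc gamma delta.

Definition Aut_disc (gamma : C -> C) : Prop :=
  holomorphic_self_map gamma /\
  exists delta : C -> C, is_disc_inverse gamma delta.

Definition compact_set {T : UniformSpace} (K : T -> Prop) : Prop :=
  forall (I : Type) (U : I -> T -> Prop),
    (forall i : I, open (U i)) ->
    (forall x : T, K x -> exists i : I, U i x) ->
    exists l : list I, forall x : T, K x -> exists i : I, In i l /\ U i x.

Definition cv_uniformly_on (K : C -> Prop) (u : nat -> C -> C) (h : C -> C)
  : Prop :=
  forall eps : R, 0 < eps ->
    exists N : nat, forall n : nat, (N <= n)%nat ->
      forall z : C, K z -> Cmod (u n z - h z)%C < eps.

Definition cv_uniformly_on_compacts (u : nat -> C -> C) (h : C -> C)
  : Prop :=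
  forall K : C -> Prop,
    compact_set K -> (forall z : C, K z -> unit_disc z) ->
    cv_uniformly_on K u h.

Definition iterate (f : C -> C) (n : nat) (z : C) : C := Nat.iter n f z.

Definition artanh (t : R) : R := / 2 * ln ((1 + t) / (1 - t)).

Definition poincare_dist (z1 z2 : C) : R :=
  artanh (Cmod ((z2 - z1) / (1 - Cconj z1 * z2))%C).

(* [gamma_inv n] plays the role of the inverse of [gamma n] in Aut(D). *)
Definition left_straightening (f h : C -> C) : Prop :=
  holomorphic_self_map h /\
  exists gamma gamma_inv : nat -> C -> C,
    (forall n : nat, Aut_disc (gamma n)) /\
    (forall n : nat, is_disc_inverse (gamma n) (gamma_inv n)) /\
    cv_uniformly_on_compacts
      (fun (n : nat) (z : C) => gamma_inv n (iterate f n z)) h.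

(* [Lim_seq] is a total operator, meaningful when the sequence converges; the
   value is kept in [Rbar] so that no infinite value is silently sent to 0. *)
Definition hyperbolic_step (f : C -> C) (z : C) : Rbar :=
  Lim_seq (fun n : nat => poincare_dist (iterate f n z) (iterate f (S n) z)).

(* Main.v *)
Require Import Defs.
From Stdlib Require Import Reals Lra Lia Classical IndefiniteDescription.
From Coquelicot Require Import Coquelicot.
Open Scope R_scope.

(** The maps [gamma n] are isometries for the Poincare distance, so
    [omega (f^n z, f^n w)] equals the distance between the points
    [gamma_n^-1 (f^n z)] and [gamma_n^-1 (f^n w)], which tend to [h z] and [h w]
    because a one-point set is compact. The distance is continuous, hence the first
    limit. The second claim is the case [w = f z], since [f^(n+1) z] is
    [f^n (f z)].

    The substance is the invariance of the distance under automorphisms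
    ([pseudo_dist_of_disc_inverse]). It follows from the Schwarz-Pick lemma
    ([schwarz_pick]) applied to [gamma n] and to its inverse, and Schwarz-Pick
    has to be derived from complex differentiability at each point, without any
    continuity of the derivative. The starting point is Goursat's theorem on
    rectangles ([goursat]), proved by quartering. Composed with the
    exponential, Goursat's theorem shows that the mean of a holomorphic function
    over a circle about [0] does not depend on the radius, which gives the
    maximum principle at the center ([Cmod_center_le_of_circle]). Moebius maps
    bring every situation back to the center, so this is enough. Schwarz's lemma
    ([schwarz_zero_at]) needs a quotient with an apparent singularity at a zero
    [a]; instead of removing it, the maximum principle is applied to [w - a]
    times the [n]-th power of the quotient, which is differentiable at [a] as
    soon as the quotient is continuous there, and [n] tends to infinity. *)

(** * Continuity and slopes *)

(** The uniform structure is the one of [C] as an absolute-valued ring: its balls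
    are round, where those of the product structure on [R * R] are squares. *)
Definition ccont (q : C -> C) (z : C) : Prop :=
  @continuous (AbsRing_UniformSpace C_AbsRing) (AbsRing_UniformSpace C_AbsRing)
    q z.

Lemma ccont_eps (q : C -> C) (z : C) :
  ccont q z <->
  forall eps : R, 0 < eps -> exists delta : R, 0 < delta /\
    forall w : C, Cmod (w - z) < delta -> Cmod (q w - q z) < eps.
Proof.
  split.
  - intros Hq eps Heps.
    destruct (Hq (fun y => Cmod (y - q z) < eps)) as [d Hd].
    + exists (mkposreal eps Heps). intros y Hy. exact Hy.
    + exists d. split. { apply cond_pos. } exact Hd.
  - intros H P [e He].
    destruct (H e (cond_pos e)) as [d [Hd Hq]].
    exists (mkposreal d Hd). intros w Hw. apply He, Hq, Hw.
Qed.

Lemma ccont_ext (p q : C -> C) (z : C) :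
  (forall w, p w = q w) -> ccont p z -> ccont q z.
Proof.
  intros E. rewrite !ccont_eps. intros H eps Heps.
  destruct (H eps Heps) as [d [Hd Hw]]. exists d. split; [exact Hd|].
  intros w. rewrite <- !E. apply Hw.
Qed.

Lemma ccont_const (c z : C) : ccont (fun _ => c) z.
Proof.
  exact (@continuous_const (AbsRing_UniformSpace C_AbsRing)
    (AbsRing_UniformSpace C_AbsRing) c z).
Qed.

Lemma ccont_id (z : C) : ccont (fun w => w) z.
Proof. exact (@continuous_id (AbsRing_UniformSpace C_AbsRing) z). Qed.

Lemma ccont_plus (f g : C -> C) (z : C) :
  ccont f z -> ccont g z -> ccont (fun w => f w + g w)%C z.
Proof.
  exact (@continuous_plus (AbsRing_UniformSpace C_AbsRing) _
    (AbsRing_NormedModule C_AbsRing) f g z).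
Qed.

Lemma ccont_mult (f g : C -> C) (z : C) :
  ccont f z -> ccont g z -> ccont (fun w => f w * g w)%C z.
Proof. exact (@continuous_mult (AbsRing_UniformSpace C_AbsRing)
    C_AbsRing f g z). Qed.

Lemma ccont_comp (f g : C -> C) (z : C) :
  ccont g z -> ccont f (g z) -> ccont (fun w => f (g w)) z.
Proof.
  exact (@continuous_comp (AbsRing_UniformSpace C_AbsRing)
    (AbsRing_UniformSpace C_AbsRing)
    (AbsRing_UniformSpace C_AbsRing) g f z).
Qed.

Lemma ccont_pow (f : C -> C) (n : nat) (z : C) :
  ccont f z -> ccont (fun w => f w ^ n)%C z.
Proof.
  intros Hf. induction n as [|n IH].
  - apply ccont_const.
  - exact (ccont_mult f (fun w => f w ^ n)%C z Hf IH).
Qed.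

(** Complex differentiability in Caratheodory's form: the difference quotient
    extends to a function [q] that is continuous at [z], with [q z] the
    derivative. The rules of calculus become identities between slopes, and a
    zero of [f] comes with a factorization [f w = q w * (w - z)]. *)
Definition cdiff (f : C -> C) (z : C) : Prop :=
  exists q : C -> C,
    ccont q z /\ forall w : C, (f w - f z = q w * (w - z))%C.

Lemma cdiff_of_approx (f : C -> C) (z d : C) :
  (forall eps : R, 0 < eps -> exists delta : R, 0 < delta /\
     forall w : C, Cmod (w - z) < delta ->
       Cmod (f w - f z - d * (w - z)) <= eps * Cmod (w - z)) ->
  cdiff f z.
Proof.
  intros H.
  exists (fun w => if Ceq_dec w z then d else ((f w - f z) / (w - z))%C).
  split.
  - apply ccont_eps. intros eps Heps.
    destruct (H (eps / 2)) as [delta [Hdelta Hw]]. { lra. }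
    exists delta. split. { exact Hdelta. } intros w Hwz.
    destruct (Ceq_dec z z) as [_|n]; [|now elim n].
    destruct (Ceq_dec w z) as [->|n].
    + replace (d - d)%C with (RtoC 0) by ring. rewrite Cmod_0. exact Heps.
    + assert (Hne : (w - z)%C <> 0).
      { intros E. apply n. replace w with (w - z + z)%C by ring.
        rewrite E. ring. }
      replace ((f w - f z) / (w - z) - d)%C
        with ((f w - f z - d * (w - z)) / (w - z))%C by (field; exact Hne).
      rewrite Cmod_div by exact Hne.
      apply Cmod_gt_0 in Hne.
      apply Rle_lt_trans with (eps / 2); [|lra].
      apply Rle_div_l; [exact Hne|]. apply Hw, Hwz.
  - intros w. destruct (Ceq_dec w z) as [->|n].
    + ring.
    + field. intros E. apply n. replace w with (w - z + z)%C by ring.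
      rewrite E. ring.
Qed.

Lemma cdiff_approx (f : C -> C) (z : C) :
  cdiff f z -> exists d : C,
  forall eps : R, 0 < eps -> exists delta : R, 0 < delta /\
     forall w : C, Cmod (w - z) < delta ->
       Cmod (f w - f z - d * (w - z)) <= eps * Cmod (w - z).
Proof.
  intros [q [Hq Hf]]. exists (q z). intros eps Heps.
  destruct (proj1 (ccont_eps q z) Hq eps Heps) as [delta [Hdelta Hw]].
  exists delta. split. { exact Hdelta. } intros w Hwz. rewrite Hf.
  replace (q w * (w - z) - q z * (w - z))%C
    with ((q w - q z) * (w - z))%C by ring.
  rewrite Cmod_mult. apply Rmult_le_compat_r. { apply Cmod_ge_0. }
  apply Rlt_le, Hw, Hwz.
Qed.

Lemma cdiff_of_ex_derive (f : C -> C) (z : C) :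
  @ex_derive C_AbsRing C_NormedModule f z -> cdiff f z.
Proof.
  intros [d [_ Hd]]. apply (cdiff_of_approx f z d). intros eps Heps.
  destruct (Hd z (fun P H => H) (mkposreal eps Heps)) as [delta Hdelta].
  exists delta. split. { apply cond_pos. } intros w Hw.
  specialize (Hdelta w Hw).
  replace (f w - f z - d * (w - z))%C
    with (f w - f z - (w - z) * d)%C by ring.
  exact Hdelta.
Qed.

Lemma cdiff_ext_loc (f g : C -> C) (z : C) (r : R) :
  0 < r -> (forall w, Cmod (w - z) < r -> f w = g w) ->
  cdiff f z -> cdiff g z.
Proof.
  intros Hr Heq Hf. destruct (cdiff_approx f z Hf) as [d Hd].
  apply (cdiff_of_approx g z d). intros eps Heps.
  destruct (Hd eps Heps) as [delta [Hdelta Hw]].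
  exists (Rmin delta r). split. { now apply Rmin_glb_lt. }
  intros w Hwz.
  rewrite <- (Heq w), <- (Heq z).
  - apply Hw. eapply Rlt_le_trans; [exact Hwz|apply Rmin_l].
  - replace (z - z)%C with (RtoC 0) by ring. now rewrite Cmod_0.
  - eapply Rlt_le_trans; [exact Hwz|apply Rmin_r].
Qed.

Lemma cdiff_cont (f : C -> C) (z : C) : cdiff f z -> ccont f z.
Proof.
  intros [q [Hq Hf]].
  apply (ccont_ext (fun w => q w * (w + - z) + f z)%C).
  - intros w. transitivity (f w - f z + f z)%C; [|ring]. rewrite Hf. reflexivity.
  - apply ccont_plus; [|apply ccont_const]. apply ccont_mult; [exact Hq|].
    apply ccont_plus; [apply ccont_id|apply ccont_const].
Qed.

Lemma cdiff_const (c z : C) : cdiff (fun _ => c) z.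
Proof. exists (fun _ => 0). split; [apply ccont_const|]. intros; ring. Qed.

Lemma cdiff_id (z : C) : cdiff (fun w => w) z.
Proof. exists (fun _ => 1). split; [apply ccont_const|]. intros; ring. Qed.

Lemma cdiff_plus (f g : C -> C) (z : C) :
  cdiff f z -> cdiff g z -> cdiff (fun w => f w + g w)%C z.
Proof.
  intros [p [Hp Hf]] [q [Hq Hg]]. exists (fun w => p w + q w)%C.
  split; [now apply ccont_plus|]. intros w.
  replace (f w + g w - (f z + g z))%C
    with ((f w - f z) + (g w - g z))%C by ring.
  rewrite Hf, Hg. ring.
Qed.

Lemma cdiff_mult (f g : C -> C) (z : C) :
  cdiff f z -> cdiff g z -> cdiff (fun w => f w * g w)%C z.
Proof.
  intros [p [Hp Hf]] Hg'. pose proof (cdiff_cont g z Hg') as Hgc.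
  destruct Hg' as [q [Hq Hg]].
  exists (fun w => p w * g w + f z * q w)%C. split.
  - apply ccont_plus; apply ccont_mult; auto using ccont_const.
  - intros w.
    replace (f w * g w - f z * g z)%C
      with ((f w - f z) * g w + f z * (g w - g z))%C by ring.
    rewrite Hf, Hg. ring.
Qed.

Lemma cdiff_pow (f : C -> C) (n : nat) (z : C) :
  cdiff f z -> cdiff (fun w => f w ^ n)%C z.
Proof.
  intros Hf. induction n as [|n IH].
  - exact (cdiff_const 1 z).
  - exact (cdiff_mult f (fun w => f w ^ n)%C z Hf IH).
Qed.

Lemma cdiff_comp (f g : C -> C) (z : C) :
  cdiff g z -> cdiff f (g z) -> cdiff (fun w => f (g w)) z.
Proof.
  intros Hg' [p [Hp Hf]]. pose proof (cdiff_cont g z Hg') as Hgc.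
  destruct Hg' as [q [Hq Hg]].
  exists (fun w => p (g w) * q w)%C. split.
  - apply ccont_mult; [now apply (ccont_comp p g)|exact Hq].
  - intros w. rewrite Hf, Hg. ring.
Qed.

Lemma cdiff_inv (z : C) : z <> 0 -> cdiff Cinv z.
Proof.
  intros Hz. pose proof (proj1 (Cmod_gt_0 z) Hz) as Hm.
  apply (cdiff_of_approx Cinv z (- / (z * z))%C). intros eps Heps.
  set (m := Cmod z) in *.
  (* The remainder is [(w - z)^2 / (w z^2)], and [|w| > m / 2] as soon as
     [|w - z| < m / 2]. *)
  assert (Hpos : 0 < eps * (m * m * m) / 2).
  { apply Rdiv_lt_0_compat; [|lra]. repeat apply Rmult_lt_0_compat; lra. }
  exists (Rmin (m / 2) (eps * (m * m * m) / 2)). split.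
  { apply Rmin_glb_lt; lra. }
  intros w Hw.
  assert (H1 : Cmod (w - z) < m / 2)
    by (eapply Rlt_le_trans; [exact Hw|apply Rmin_l]).
  assert (H2 : Cmod (w - z) < eps * (m * m * m) / 2)
    by (eapply Rlt_le_trans; [exact Hw|apply Rmin_r]).
  assert (Hwm : m / 2 < Cmod w).
  { assert (m <= Cmod w + Cmod (w - z)); [|lra].
    unfold m. replace z with (w + - (w - z))%C at 1 by ring.
    eapply Rle_trans; [apply Cmod_triangle|]. rewrite Cmod_opp. lra. }
  assert (Hw0 : w <> 0) by (apply Cmod_gt_0; lra).
  replace (/ w - / z - - / (z * z) * (w - z))%C
    with ((w - z) * ((w - z) / (w * (z * z))))%C
    by (field; split; assumption).
  rewrite Cmod_mult, Rmult_comm. apply Rmult_le_compat_r; [apply Cmod_ge_0|].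
  assert (Hzz : (z * z)%C <> 0) by now apply Cmult_neq_0.
  rewrite Cmod_div by now apply Cmult_neq_0.
  rewrite !Cmod_mult. fold m.
  apply Rle_div_l; [repeat apply Rmult_lt_0_compat; lra|].
  assert (eps * (m / 2 * (m * m)) <= eps * (Cmod w * (m * m))); [|nra].
  apply Rmult_le_compat_l; [lra|]. apply Rmult_le_compat_r; nra.
Qed.

Lemma cdiff_div (f g : C -> C) (z : C) :
  cdiff f z -> cdiff g z -> g z <> 0 -> cdiff (fun w => f w / g w)%C z.
Proof.
  intros Hf Hg H0. apply cdiff_mult; [exact Hf|].
  apply (cdiff_comp Cinv g); [exact Hg|now apply cdiff_inv].
Qed.

(** * The complex exponential *)

Definition cexp (z : C) : C :=
  (exp (Re z) * cos (Im z), exp (Re z) * sin (Im z)).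

Lemma cexp_add (z w : C) : cexp (z + w) = (cexp z * cexp w)%C.
Proof.
  destruct z as [a b], w as [c d]. unfold cexp, Cmult, Cplus; simpl.
  rewrite exp_plus, cos_plus, sin_plus. f_equal; ring.
Qed.

Lemma Cmod_cexp (z : C) : Cmod (cexp z) = exp (Re z).
Proof.
  destruct z as [a b]. unfold cexp, Cmod; simpl.
  replace (exp a * cos b * (exp a * cos b * 1) + exp a * sin b * (exp a * sin b * 1))
    with (exp a * exp a * (sin b * sin b + cos b * cos b)) by ring.
  fold (Rsqr (sin b)). fold (Rsqr (cos b)). rewrite sin2_cos2, Rmult_1_r.
  apply sqrt_square. apply Rlt_le, exp_pos.
Qed.

Lemma Cmod_le_abs (x y : R) : Cmod (x, y) <= Rabs x + Rabs y.
Proof.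
  replace ((x, y) : C) with (RtoC x + Ci * RtoC y)%C.
  - eapply Rle_trans; [apply Cmod_triangle|].
    rewrite Cmod_mult, Cmod_Ci, !Cmod_R. lra.
  - unfold Ci, Cmult, Cplus, RtoC; simpl. f_equal; ring.
Qed.

Lemma im_le_Cmod (z : C) : Rabs (Im z) <= Cmod z.
Proof. eapply Rle_trans; [apply Rmax_r|apply (Rmax_Cmod z)]. Qed.

Lemma approx_at_0 (f : R -> R) (l : R) :
  derivable_pt_lim f 0 l -> forall eps : R, 0 < eps ->
  exists delta : R, 0 < delta /\
    forall x : R, Rabs x < delta -> Rabs (f x - f 0 - l * x) <= eps * Rabs x.
Proof.
  intros H eps Heps. destruct (H eps Heps) as [d Hd].
  exists d. split. { apply cond_pos. } intros x Hx.
  destruct (Req_dec x 0) as [->|Hx0].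
  - rewrite Rmult_0_r, !Rminus_diag, Rabs_R0. lra.
  - specialize (Hd x Hx0 Hx). rewrite Rplus_0_l in Hd.
    replace (f x - f 0 - l * x) with (((f x - f 0) / x - l) * x)
      by (field; exact Hx0).
    rewrite Rabs_mult. apply Rmult_le_compat_r; [apply Rabs_pos|lra].
Qed.

(** With [exp x = 1 + x + A], [sin y = y + B] and [cos y = 1 + D], the remainder
    consists of the negligible terms [A], [B], [D] and of the products
    [D * (x + A)] and [(x + A) * (y + B)], of second order. *)
Lemma cexp_approx_0 (eps : R) : 0 < eps -> exists delta : R, 0 < delta /\
  forall h : C, Cmod h < delta -> Cmod (cexp h - 1 - h) <= eps * Cmod h.
Proof.
  intros Heps. set (e := Rmin 1 (eps / 10)).
  assert (He : 0 < e) by (apply Rmin_glb_lt; lra).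
  assert (He1 : e <= 1) by apply Rmin_l.
  assert (He2 : e <= eps / 10) by apply Rmin_r.
  pose proof (derivable_pt_lim_exp 0) as E1. rewrite exp_0 in E1.
  pose proof (derivable_pt_lim_sin 0) as E2. rewrite cos_0 in E2.
  pose proof (derivable_pt_lim_cos 0) as E3. rewrite sin_0, Ropp_0 in E3.
  destruct (approx_at_0 exp 1 E1 e He) as [d1 [Hd1 H1]].
  destruct (approx_at_0 sin 1 E2 e He) as [d2 [Hd2 H2]].
  destruct (approx_at_0 cos 0 E3 e He) as [d3 [Hd3 H3]].
  rewrite exp_0 in H1. rewrite sin_0 in H2. rewrite cos_0 in H3.
  exists (Rmin (Rmin d1 d2) (Rmin d3 e)). split.
  { apply Rmin_glb_lt; apply Rmin_glb_lt; assumption. }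
  intros [x y] Hh.
  pose proof (re_le_Cmod (x, y)) as Hx. pose proof (im_le_Cmod (x, y)) as Hy.
  simpl in Hx, Hy. set (m := Cmod (x, y)) in *.
  assert (Hm : m < d1 /\ m < d2 /\ m < d3 /\ m < e).
  { repeat split; (eapply Rlt_le_trans; [exact Hh|]).
    - eapply Rle_trans; [apply Rmin_l|apply Rmin_l].
    - eapply Rle_trans; [apply Rmin_l|apply Rmin_r].
    - eapply Rle_trans; [apply Rmin_r|apply Rmin_l].
    - eapply Rle_trans; [apply Rmin_r|apply Rmin_r]. }
  destruct Hm as [M1 [M2 [M3 M4]]].
  specialize (H1 x ltac:(lra)). specialize (H2 y ltac:(lra)).
  specialize (H3 y ltac:(lra)).
  set (A := exp x - 1 - 1 * x) in *. set (B := sin y - 0 - 1 * y) in *.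
  set (D := cos y - 1 - 0 * y) in *.
  assert (HA : Rabs A <= e * m) by nra.
  assert (HB : Rabs B <= e * m) by nra.
  assert (HD : Rabs D <= e * m) by nra.
  replace (cexp (x, y) - 1 - (x, y))%C
    with ((A + D + D * (x + A)), (B + (x + A) * (y + B))).
  2:{ unfold cexp, Cminus, Cplus, Copp, RtoC, A, B, D; simpl. f_equal; ring. }
  eapply Rle_trans; [apply Cmod_le_abs|].
  assert (Hm0 : 0 <= m) by apply Cmod_ge_0.
  assert (Hem : e * m <= m) by nra.
  assert (HxA : Rabs (x + A) <= 2 * m)
    by (eapply Rle_trans; [apply Rabs_triang|lra]).
  assert (HyB : Rabs (y + B) <= 2 * m)
    by (eapply Rle_trans; [apply Rabs_triang|lra]).
  assert (P1 : Rabs (A + D + D * (x + A)) <= e * m + e * m + e * m * (2 * m)).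
  { eapply Rle_trans; [apply Rabs_triang|]. apply Rplus_le_compat.
    - eapply Rle_trans; [apply Rabs_triang|lra].
    - rewrite Rabs_mult. apply Rmult_le_compat; auto using Rabs_pos. }
  assert (P2 : Rabs (B + (x + A) * (y + B)) <= e * m + 2 * m * (2 * m)).
  { eapply Rle_trans; [apply Rabs_triang|]. apply Rplus_le_compat; [lra|].
    rewrite Rabs_mult. apply Rmult_le_compat; auto using Rabs_pos. }
  assert (m * m <= e * m) by nra.
  assert (e * m * m <= e * m) by nra.
  nra.
Qed.

(** The functional equation moves the expansion at [0] to any point. *)
Lemma cdiff_cexp (z : C) : cdiff cexp z.
Proof.
  apply (cdiff_of_approx cexp z (cexp z)). intros eps Heps.
  assert (HE : 0 < Cmod (cexp z)) by (rewrite Cmod_cexp; apply exp_pos).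
  destruct (cexp_approx_0 (eps / Cmod (cexp z))) as [d [Hd H]].
  { now apply Rdiv_lt_0_compat. }
  exists d. split. { exact Hd. } intros w Hw.
  specialize (H _ Hw). replace w with (z + (w - z))%C at 1 by ring.
  rewrite cexp_add.
  replace (cexp z * cexp (w - z) - cexp z - cexp z * (w - z))%C
    with (cexp z * (cexp (w - z) - 1 - (w - z)))%C by ring.
  rewrite Cmod_mult.
  apply Rmult_le_compat_l with (r := Cmod (cexp z)) in H; [|lra].
  eapply Rle_trans; [exact H|]. right. field. lra.
Qed.

(** * Goursat's theorem on a rectangle *)

Lemma nested_intervals (x : nat -> R) (L : R) :
  0 <= L ->
  (forall n, x n <= x (S n)) ->
  (forall n, x (S n) <= x n + L / 2 ^ S n) ->
  exists s : R, forall n, x n <= s <= x n + L / 2 ^ n.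
Proof.
  intros HL Hup Hdown.
  assert (Hw : forall n, 0 <= L / 2 ^ n).
  { intros n. apply Rdiv_le_0_compat; [exact HL|]. apply pow_lt; lra. }
  assert (Hhalf : forall n, L / 2 ^ n = L / 2 ^ S n + L / 2 ^ S n).
  { intros n. simpl. field. apply pow_nonzero; lra. }
  assert (Hmono : forall n k, x n <= x (k + n)%nat
      /\ x (k + n)%nat + L / 2 ^ (k + n) <= x n + L / 2 ^ n).
  { intros n k. induction k as [|k [IH1 IH2]].
    - split; simpl; lra.
    - specialize (Hup (k + n)%nat). specialize (Hdown (k + n)%nat).
      specialize (Hhalf (k + n)%nat). change (S k + n)%nat with (S (k + n)).
      split; lra. }
  assert (Hle : forall m n, x m <= x n + L / 2 ^ n).
  { intros m n. destruct (Nat.le_ge_cases m n) as [H|H].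
    - destruct (Hmono m (n - m)%nat) as [H1 _].
      replace (n - m + m)%nat with n in H1 by lia. specialize (Hw n). lra.
    - destruct (Hmono n (m - n)%nat) as [_ H2].
      replace (m - n + n)%nat with m in H2 by lia. specialize (Hw m). lra. }
  destruct (completeness (fun y => exists n, y = x n)) as [s [Hs1 Hs2]].
  - exists (x 0%nat + L / 2 ^ 0). intros y [n ->]. apply Hle.
  - exists (x 0%nat). now exists 0%nat.
  - exists s. intros n. split.
    + apply Hs1. now exists n.
    + apply Hs2. intros y [m ->]. apply Hle.
Qed.

(** If the conclusion failed, some quarter of a bad rectangle would always be
    bad; the nested bad rectangles shrink to a point that they all contain, and
    [P] holds on the small ones. The local hypothesis speaks of the rectangles
    that contain the point, because differentiability at a point controls a
    function at the scale of the distance to that point. *)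
Lemma quartering_induction (P : R -> R -> R -> R -> Prop) (a b c d : R) :
  a <= b -> c <= d ->
  (forall a' b' c' d', a <= a' <= b' -> b' <= b -> c <= c' <= d' -> d' <= d ->
     let m := (a' + b') / 2 in let n := (c' + d') / 2 in
     P a' m c' n -> P m b' c' n -> P a' m n d' -> P m b' n d' ->
     P a' b' c' d') ->
  (forall s t, a <= s <= b -> c <= t <= d -> exists delta, 0 < delta /\
     forall a' b' c' d', a <= a' <= s -> s <= b' <= b ->
       c <= c' <= t -> t <= d' <= d ->
       b' - a' < delta -> d' - c' < delta -> P a' b' c' d') ->
  P a b c d.
Proof.
  intros Hab Hcd Hsplit Hlocal. apply NNPP. intros Hbad0.
  set (L := b - a). set (H := d - c).
  (* [bad n p]: the rectangle of generation [n] with lower left corner [p]. *)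
  set (bad := fun (n : nat) (p : R * R) =>
    (a <= fst p /\ fst p + L / 2 ^ n <= b) /\
    (c <= snd p /\ snd p + H / 2 ^ n <= d) /\
    ~ P (fst p) (fst p + L / 2 ^ n) (snd p) (snd p + H / 2 ^ n)).
  assert (HLn : forall n, 0 <= L / 2 ^ n).
  { intros n. apply Rdiv_le_0_compat; [unfold L; lra|apply pow_lt; lra]. }
  assert (HHn : forall n, 0 <= H / 2 ^ n).
  { intros n. apply Rdiv_le_0_compat; [unfold H; lra|apply pow_lt; lra]. }
  assert (Hhalf : forall K n, K / 2 ^ n = K / 2 ^ S n + K / 2 ^ S n).
  { intros K n. simpl. field. apply pow_nonzero; lra. }
  assert (Hstep : forall np : nat * (R * R), exists p' : R * R,
    bad (fst np) (snd np) -> bad (S (fst np)) p' /\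
    (fst (snd np) <= fst p' <= fst (snd np) + L / 2 ^ S (fst np)) /\
    (snd (snd np) <= snd p' <= snd (snd np) + H / 2 ^ S (fst np))).
  { intros [n [x y]]. simpl fst. simpl snd.
    apply NNPP. intros Hno. apply Hno.
    exists (x, y). intros Hb. exfalso.
    unfold bad in Hb; simpl fst in Hb; simpl snd in Hb.
    destruct Hb as [Hx [Hy HP]]. apply HP.
    pose proof (HLn (S n)) as l0. pose proof (HHn (S n)) as h0.
    pose proof (Hhalf L n) as l1. pose proof (Hhalf H n) as h1.
    set (l := L / 2 ^ S n) in *. set (h := H / 2 ^ S n) in *.
    assert (Hquarter : forall x' y', x <= x' <= x + l -> y <= y' <= y + h ->
        P x' (x' + l) y' (y' + h)).
    { intros x' y' Hx' Hy'. apply NNPP. intros HP'. apply Hno.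
      exists (x', y'). intros _. unfold bad. simpl fst. simpl snd.
      fold l. fold h. repeat split; try lra. exact HP'. }
    apply Hsplit; try lra.
    - replace ((x + (x + L / 2 ^ n)) / 2) with (x + l) by lra.
      replace ((y + (y + H / 2 ^ n)) / 2) with (y + h) by lra.
      apply Hquarter; lra.
    - replace ((x + (x + L / 2 ^ n)) / 2) with (x + l) by lra.
      replace ((y + (y + H / 2 ^ n)) / 2) with (y + h) by lra.
      replace (x + L / 2 ^ n) with (x + l + l) by lra.
      apply Hquarter; lra.
    - replace ((x + (x + L / 2 ^ n)) / 2) with (x + l) by lra.
      replace ((y + (y + H / 2 ^ n)) / 2) with (y + h) by lra.
      replace (y + H / 2 ^ n) with (y + h + h) by lra.
      apply Hquarter; lra.
    - replace ((x + (x + L / 2 ^ n)) / 2) with (x + l) by lra.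
      replace ((y + (y + H / 2 ^ n)) / 2) with (y + h) by lra.
      replace (x + L / 2 ^ n) with (x + l + l) by lra.
      replace (y + H / 2 ^ n) with (y + h + h) by lra.
      apply Hquarter; lra. }
  destruct (functional_choice _ Hstep) as [next Hnext].
  set (p := fix p (n : nat) : R * R :=
    match n with O => (a, c) | S n => next (n, p n) end).
  assert (Hbad : forall n, bad n (p n)).
  { induction n as [|n IH].
    - unfold bad; simpl. replace (a + L / 1) with b by (unfold L; field).
      replace (c + H / 1) with d by (unfold H; field).
      repeat split; try lra. exact Hbad0.
    - apply (Hnext (n, p n)). exact IH. }
  destruct (nested_intervals (fun n => fst (p n)) L) as [s Hs].
  { unfold L; lra. }
  { intros n. apply (Hnext (n, p n)), Hbad. }
  { intros n. apply (Hnext (n, p n)), Hbad. }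
  destruct (nested_intervals (fun n => snd (p n)) H) as [t Ht].
  { unfold H; lra. }
  { intros n. apply (Hnext (n, p n)), Hbad. }
  { intros n. apply (Hnext (n, p n)), Hbad. }
  cbv beta in Hs, Ht.
  destruct (Hlocal s t) as [delta [Hdelta Hsmall]].
  { specialize (Hs 0%nat). destruct (Hbad 0%nat) as [? _]. lra. }
  { specialize (Ht 0%nat). destruct (Hbad 0%nat) as [_ [? _]]. lra. }
  assert (Hlim : exists n, L / 2 ^ n < delta /\ H / 2 ^ n < delta).
  { destruct (pow_lt_1_zero (/ 2)) with (y := delta / (L + H + 1)) as [n Hn].
    - rewrite Rabs_pos_eq; lra.
    - apply Rdiv_lt_0_compat; [exact Hdelta|unfold L, H; lra].
    - exists n. specialize (Hn n (le_n n)).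
      rewrite Rabs_pos_eq in Hn by (apply pow_le; lra).
      rewrite pow_inv in Hn. unfold Rdiv at 1 2.
      assert (0 <= / 2 ^ n)
        by (apply Rlt_le, Rinv_0_lt_compat, pow_lt; lra).
      apply Rlt_div_r in Hn; [|unfold L, H; lra].
      assert (0 <= L /\ 0 <= H) by (unfold L, H; lra). split; nra. }
  destruct Hlim as [n [Hn1 Hn2]].
  destruct (Hbad n) as [B1 [B2 B3]]. apply B3.
  specialize (Hs n). specialize (Ht n).
  apply Hsmall; lra.
Qed.

(** The imaginary part of the integral of [G(z) dz] along the boundary of
    [[a, b] x [c, d]], counterclockwise: [Im (G dz) = Re G dt + Im G ds] for
    [z = s + i t]. Opposite sides are grouped, so that each of the two integrals
    has a small integrand when the rectangle is small. *)
Definition contour (G : C -> C) (a b c d : R) : R :=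
  RInt (fun t => Re (G (b, t)) - Re (G (a, t))) c d
  - RInt (fun s => Im (G (s, d)) - Im (G (s, c))) a b.

Lemma ccont_vertical (G : C -> C) (x y : R) :
  ccont G (x, y) -> continuous (fun t => Re (G (x, t))) y.
Proof.
  intros HG. apply filterlim_locally. intros eps.
  destruct (proj1 (ccont_eps G (x, y)) HG eps (cond_pos eps)) as [d [Hd H]].
  exists (mkposreal d Hd). intros t Ht.
  change (Rabs (Re (G (x, t)) - Re (G (x, y))) < eps).
  replace (Re (G (x, t)) - Re (G (x, y))) with (Re (G (x, t) - G (x, y))%C)
    by reflexivity.
  eapply Rle_lt_trans; [apply re_le_Cmod|]. apply H.
  change (Rabs (t - y) < d) in Ht.
  eapply Rle_lt_trans; [|exact Ht].
  replace ((x, t) - (x, y))%C with ((0, t - y) : C)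
    by (unfold Cminus, Cplus, Copp; simpl; f_equal; ring).
  eapply Rle_trans; [apply Cmod_le_abs|]. rewrite Rabs_R0. lra.
Qed.

Lemma ccont_horizontal (G : C -> C) (x y : R) :
  ccont G (x, y) -> continuous (fun s => Im (G (s, y))) x.
Proof.
  intros HG. apply filterlim_locally. intros eps.
  destruct (proj1 (ccont_eps G (x, y)) HG eps (cond_pos eps)) as [d [Hd H]].
  exists (mkposreal d Hd). intros s Hs.
  change (Rabs (Im (G (s, y)) - Im (G (x, y))) < eps).
  replace (Im (G (s, y)) - Im (G (x, y))) with (Im (G (s, y) - G (x, y))%C)
    by reflexivity.
  eapply Rle_lt_trans; [apply im_le_Cmod|]. apply H.
  change (Rabs (s - x) < d) in Hs.
  eapply Rle_lt_trans; [|exact Hs].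
  replace ((s, y) - (x, y))%C with ((s - x, 0) : C)
    by (unfold Cminus, Cplus, Copp; simpl; f_equal; ring).
  eapply Rle_trans; [apply Cmod_le_abs|]. rewrite Rabs_R0. lra.
Qed.

Section Rectangle.

Variables (G : C -> C) (a b c d : R).
Hypothesis Hdiff :
  forall s t, a <= s <= b -> c <= t <= d -> cdiff G (s, t).

Lemma ex_RInt_vertical (x c' d' : R) :
  a <= x <= b -> c <= c' <= d' -> d' <= d ->
  ex_RInt (fun t => Re (G (x, t))) c' d'.
Proof.
  intros Hx Hc Hd.
  apply (@ex_RInt_continuous R_CompleteNormedModule). intros t Ht.
  rewrite Rmin_left, Rmax_right in Ht by lra.
  apply ccont_vertical, cdiff_cont, Hdiff; lra.
Qed.

Lemma ex_RInt_horizontal (y a' b' : R) :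
  c <= y <= d -> a <= a' <= b' -> b' <= b ->
  ex_RInt (fun s => Im (G (s, y))) a' b'.
Proof.
  intros Hy Ha Hb.
  apply (@ex_RInt_continuous R_CompleteNormedModule). intros s Hs.
  rewrite Rmin_left, Rmax_right in Hs by lra.
  apply ccont_horizontal, cdiff_cont, Hdiff; lra.
Qed.

Lemma contour_expand (a' b' c' d' : R) :
  a <= a' <= b' -> b' <= b -> c <= c' <= d' -> d' <= d ->
  contour G a' b' c' d' =
  RInt (fun t => Re (G (b', t))) c' d' - RInt (fun t => Re (G (a', t))) c' d'
  - (RInt (fun s => Im (G (s, d'))) a' b' - RInt (fun s => Im (G (s, c'))) a' b').
Proof.
  intros Ha Hb Hc Hd. unfold contour. f_equal; [|f_equal].
  - apply (@RInt_minus R_CompleteNormedModule); apply ex_RInt_vertical; lra.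
  - apply (@RInt_minus R_CompleteNormedModule); apply ex_RInt_horizontal; lra.
Qed.

Lemma contour_quarter (a' b' c' d' m n : R) :
  a <= a' <= m -> m <= b' <= b -> c <= c' <= n -> n <= d' <= d ->
  contour G a' b' c' d' =
  contour G a' m c' n + contour G m b' c' n
  + contour G a' m n d' + contour G m b' n d'.
Proof.
  intros Ha Hb Hc Hd. rewrite !contour_expand by lra.
  assert (V : forall x, a <= x <= b -> RInt (fun t => Re (G (x, t))) c' d'
    = RInt (fun t => Re (G (x, t))) c' n + RInt (fun t => Re (G (x, t))) n d').
  { intros x Hx. symmetry.
    apply (@RInt_Chasles R_CompleteNormedModule); apply ex_RInt_vertical; lra. }
  assert (W : forall y, c <= y <= d -> RInt (fun s => Im (G (s, y))) a' b'
    = RInt (fun s => Im (G (s, y))) a' m + RInt (fun s => Im (G (s, y))) m b').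
  { intros y Hy. symmetry.
    apply (@RInt_Chasles R_CompleteNormedModule); apply ex_RInt_horizontal; lra. }
  rewrite (V a'), (V b'), (W c'), (W d') by lra. ring.
Qed.

(** The affine part of [G] at [(s, t)] contributes [p] times the area to both
    integrals, where [p] is the real part of the derivative, and these
    contributions cancel. What is left is the integral of the remainder, at most
    [eps] times the half-perimeter pointwise. *)
Lemma contour_small (s t eps : R) :
  a <= s <= b -> c <= t <= d -> 0 < eps ->
  exists delta, 0 < delta /\
    forall a' b' c' d', a <= a' <= s -> s <= b' <= b ->
      c <= c' <= t -> t <= d' <= d ->
      b' - a' < delta -> d' - c' < delta ->
      Rabs (contour G a' b' c' d') <= 2 * eps * ((b' - a') + (d' - c')) ^ 2.
Proof.
  intros Hs Ht Heps.
  destruct (cdiff_approx G (s, t) (Hdiff s t Hs Ht)) as [[p q] HD].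
  destruct (HD eps Heps) as [delta [Hdelta Happ]].
  exists (delta / 2). split. { lra. }
  intros a' b' c' d' Ha Hb Hc Hd Hab Hcd.
  set (h := (b' - a') + (d' - c')).
  set (E := fun w : C => (G w - G (s, t) - (p, q) * (w - (s, t)))%C).
  assert (HE : forall x y, a' <= x <= b' -> c' <= y <= d' ->
      Cmod (E (x, y)) <= eps * h).
  { intros x y Hx Hy.
    assert (Hw : Cmod ((x, y) - (s, t)) <= h).
    { eapply Rle_trans; [apply (Cmod_le_abs (x - s) (y - t))|].
      unfold h. apply Rplus_le_compat; apply Rabs_le; lra. }
    eapply Rle_trans; [apply Happ; unfold h in Hw; lra|].
    apply Rmult_le_compat_l; lra. }
  assert (I1 : Rabs (RInt (fun y => Re (G (b', y)) - Re (G (a', y))) c' d'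
      - p * (b' - a') * (d' - c')) <= (d' - c') * (2 * (eps * h))).
  { assert (X : ex_RInt (fun y => Re (G (b', y)) - Re (G (a', y))) c' d').
    { apply (@ex_RInt_minus R_NormedModule); apply ex_RInt_vertical; lra. }
    replace (p * (b' - a') * (d' - c'))
      with (RInt (fun _ : R => p * (b' - a')) c' d')
      by (rewrite (@RInt_const R_CompleteNormedModule); unfold scal; simpl;
          unfold mult; simpl; ring).
    assert (Y : ex_RInt (fun _ : R => p * (b' - a')) c' d')
      by apply ex_RInt_const.
    pose proof (@RInt_minus R_CompleteNormedModule _ _ c' d' X Y) as Z.
    unfold minus, plus, opp in Z; simpl in Z.
    unfold Rminus at 1. rewrite <- Z.
    apply abs_RInt_le_const; [lra| |].
    - exact (@ex_RInt_minus R_NormedModule _ _ c' d' X Y).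
    - intros y Hy.
      replace (Re (G (b', y)) - Re (G (a', y)) + - (p * (b' - a')))
        with (Re (E (b', y)) - Re (E (a', y)))
        by (unfold E, Cminus, Cplus, Copp, Cmult, Re; simpl; ring).
      pose proof (re_le_Cmod (E (b', y))). pose proof (re_le_Cmod (E (a', y))).
      pose proof (HE b' y ltac:(lra) Hy). pose proof (HE a' y ltac:(lra) Hy).
      eapply Rle_trans; [apply Rabs_triang|]. rewrite Rabs_Ropp. lra. }
  assert (I2 : Rabs (RInt (fun x => Im (G (x, d')) - Im (G (x, c'))) a' b'
      - p * (b' - a') * (d' - c')) <= (b' - a') * (2 * (eps * h))).
  { assert (X : ex_RInt (fun x => Im (G (x, d')) - Im (G (x, c'))) a' b').
    { apply (@ex_RInt_minus R_NormedModule); apply ex_RInt_horizontal; lra. }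
    replace (p * (b' - a') * (d' - c'))
      with (RInt (fun _ : R => p * (d' - c')) a' b')
      by (rewrite (@RInt_const R_CompleteNormedModule); unfold scal; simpl;
          unfold mult; simpl; ring).
    assert (Y : ex_RInt (fun _ : R => p * (d' - c')) a' b')
      by apply ex_RInt_const.
    pose proof (@RInt_minus R_CompleteNormedModule _ _ a' b' X Y) as Z.
    unfold minus, plus, opp in Z; simpl in Z.
    unfold Rminus at 1. rewrite <- Z.
    apply abs_RInt_le_const; [lra| |].
    - exact (@ex_RInt_minus R_NormedModule _ _ a' b' X Y).
    - intros x Hx.
      replace (Im (G (x, d')) - Im (G (x, c')) + - (p * (d' - c')))
        with (Im (E (x, d')) - Im (E (x, c')))
        by (unfold E, Cminus, Cplus, Copp, Cmult, Im; simpl; ring).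
      pose proof (im_le_Cmod (E (x, d'))). pose proof (im_le_Cmod (E (x, c'))).
      pose proof (HE x d' Hx ltac:(lra)). pose proof (HE x c' Hx ltac:(lra)).
      eapply Rle_trans; [apply Rabs_triang|]. rewrite Rabs_Ropp. lra. }
  unfold contour. apply Rabs_le_between in I1. apply Rabs_le_between in I2.
  apply Rabs_le. fold h.
  replace (2 * eps * h ^ 2)
    with ((d' - c') * (2 * (eps * h)) + (b' - a') * (2 * (eps * h)))
    by (unfold h; ring).
  lra.
Qed.

(** The bound [2 eps h^2], with [h] the half-perimeter, is additive under
    quartering ([4 (h/2)^2 = h^2]) and holds near each point, hence holds for
    the whole rectangle and every [eps]. *)
Lemma goursat : a <= b -> c <= d -> contour G a b c d = 0.
Proof.
  intros Hab Hcd. apply NNPP. intros Hne.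
  apply Rabs_pos_lt in Hne. set (h := (b - a) + (d - c)).
  assert (Hh : 0 <= h) by (unfold h; lra).
  assert (Hall : forall eps, 0 < eps ->
      Rabs (contour G a b c d) <= 2 * eps * h ^ 2).
  { intros eps Heps. unfold h.
    apply (quartering_induction (fun a' b' c' d' =>
      Rabs (contour G a' b' c' d') <= 2 * eps * ((b' - a') + (d' - c')) ^ 2));
      [exact Hab|exact Hcd| |].
    - intros a' b' c' d' Ha Hb Hc Hd m n Q1 Q2 Q3 Q4.
      rewrite (contour_quarter a' b' c' d' m n) by (unfold m, n; lra).
      apply Rabs_le_between in Q1. apply Rabs_le_between in Q2.
      apply Rabs_le_between in Q3. apply Rabs_le_between in Q4.
      replace (m - a' + (n - c')) with ((b' - a' + (d' - c')) / 2) in Q1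
        by (unfold m, n; field).
      replace (b' - m + (n - c')) with ((b' - a' + (d' - c')) / 2) in Q2
        by (unfold m, n; field).
      replace (m - a' + (d' - n)) with ((b' - a' + (d' - c')) / 2) in Q3
        by (unfold m, n; field).
      replace (b' - m + (d' - n)) with ((b' - a' + (d' - c')) / 2) in Q4
        by (unfold m, n; field).
      replace (2 * eps * ((b' - a' + (d' - c')) / 2) ^ 2)
        with (2 * eps * (b' - a' + (d' - c')) ^ 2 / 4) in * by field.
      apply Rabs_le. lra.
    - intros s t Hs Ht. now apply contour_small. }
  set (k := Rabs (contour G a b c d)) in *.
  assert (Hp : 0 < h ^ 2 + 1) by (pose proof (pow2_ge_0 h); lra).
  specialize (Hall (k / (4 * (h ^ 2 + 1)))).
  assert (H1 : 0 < k / (4 * (h ^ 2 + 1))) by (apply Rdiv_lt_0_compat; lra).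
  specialize (Hall H1).
  assert (k / (4 * (h ^ 2 + 1)) * (4 * (h ^ 2 + 1)) = k) by (field; lra).
  nra.
Qed.

End Rectangle.

(** * The maximum principle at the center of a disc *)

(** In logarithmic coordinates [z = exp (s + i t)] the circles become vertical
    segments and the two horizontal sides [t = 0] and [t = 2 PI] carry the same
    values. Goursat's theorem for [F o cexp] therefore says that the mean of
    [Re F] over the circle [|z| = exp s] does not depend on [s]. On a small
    circle it is close to [Re (F 0)], on the circle of radius [r] it is at most
    [M]. *)
Lemma Re_center_le_of_circle (F : C -> C) (r M : R) :
  (forall z, unit_disc z -> cdiff F z) -> 0 < r < 1 ->
  (forall z, Cmod z = r -> Re (F z) <= M) -> Re (F 0) <= M.
Proof.
  intros HF Hr HM. apply Rnot_lt_le. intros Hlt.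
  set (eta := (Re (F 0) - M) / 2).
  assert (H0 : unit_disc 0) by (unfold unit_disc; rewrite Cmod_0; lra).
  destruct (proj1 (ccont_eps F 0) (cdiff_cont F 0 (HF 0 H0)) eta)
    as [delta [Hdelta Hnear]].
  { unfold eta; lra. }
  set (rho := Rmin r delta / 2).
  assert (Hrho : 0 < rho /\ rho < r /\ rho < delta).
  { assert (0 < Rmin r delta) by (apply Rmin_glb_lt; lra).
    pose proof (Rmin_l r delta). pose proof (Rmin_r r delta).
    unfold rho; lra. }
  set (G := fun z => F (cexp z)).
  assert (HG : forall s t, ln rho <= s <= ln r -> 0 <= t <= 2 * PI ->
      cdiff G (s, t)).
  { intros s t [_ Hs] _. apply (cdiff_comp F cexp); [apply cdiff_cexp|].
    apply HF. unfold unit_disc. rewrite Cmod_cexp. simpl.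
    apply Rle_lt_trans with r; [|lra]. rewrite <- (exp_ln r) by lra.
    destruct Hs as [Hs | ->]; [|lra]. now apply Rlt_le, exp_increasing. }
  pose proof PI_RGT_0 as Hpi.
  assert (Hln : ln rho <= ln r) by (apply Rlt_le, ln_increasing; lra).
  pose proof (goursat G (ln rho) (ln r) 0 (2 * PI) HG Hln ltac:(lra)) as Hg.
  unfold contour in Hg.
  replace (RInt (fun s => Im (G (s, 2 * PI)) - Im (G (s, 0))) (ln rho) (ln r))
    with 0 in Hg.
  2:{ rewrite (RInt_ext _ (fun _ => 0)).
      - rewrite (@RInt_const R_CompleteNormedModule).
        unfold scal; simpl; unfold mult; simpl. ring.
      - intros s _. unfold G, cexp; simpl.
        rewrite cos_2PI, sin_2PI, cos_0, sin_0. ring. }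
  assert (Hle : RInt (fun t => Re (G (ln r, t)) - Re (G (ln rho, t))) 0 (2 * PI)
      <= RInt (fun _ : R => - eta) 0 (2 * PI)).
  { apply RInt_le; [lra| |apply ex_RInt_const|].
    - apply (@ex_RInt_minus R_NormedModule);
        apply (ex_RInt_vertical G (ln rho) (ln r) 0 (2 * PI)); auto; lra.
    - intros t _.
      assert (A1 : Re (G (ln r, t)) <= M).
      { apply HM. rewrite Cmod_cexp. simpl. apply exp_ln; lra. }
      assert (A2 : Rabs (Re (G (ln rho, t)) - Re (F 0)) < eta).
      { eapply Rle_lt_trans; [apply (re_le_Cmod (G (ln rho, t) - F 0))|].
        apply Hnear. replace (cexp (ln rho, t) - 0)%C with (cexp (ln rho, t)) by ring.
        rewrite Cmod_cexp. simpl. rewrite exp_ln; lra. }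
      apply Rabs_def2 in A2. unfold eta in *. lra. }
  rewrite (@RInt_const R_CompleteNormedModule) in Hle.
  unfold scal in Hle; simpl in Hle; unfold mult in Hle; simpl in Hle.
  assert (0 < 2 * PI * eta) by (apply Rmult_lt_0_compat; unfold eta; lra).
  lra.
Qed.

(** Apply the bound on real parts to [F] multiplied by the conjugate of
    [F 0]. *)
Lemma Cmod_center_le_of_circle (F : C -> C) (r M : R) :
  (forall z, unit_disc z -> cdiff F z) -> 0 < r < 1 ->
  (forall z, Cmod z = r -> Cmod (F z) <= M) -> Cmod (F 0) <= M.
Proof.
  intros HF Hr HM. destruct (Ceq_dec (F 0) 0) as [E|Hne].
  - rewrite E, Cmod_0. eapply Rle_trans; [apply Cmod_ge_0|].
    apply (HM r). rewrite Cmod_R. apply Rabs_pos_eq; lra.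
  - pose proof (proj1 (Cmod_gt_0 _) Hne) as Hm. set (m := Cmod (F 0)) in *.
    assert (Hsq : Re (Cconj (F 0) * F 0) = m * m).
    { replace (m * m) with (m ^ 2) by ring. unfold m. rewrite Cmod2_alt.
      destruct (F 0) as [x y]. unfold Cconj, Cmult, Re, Im; simpl. ring. }
    assert (H : Re (Cconj (F 0) * F 0) <= m * M).
    { apply (Re_center_le_of_circle (fun z => Cconj (F 0) * F z)%C r);
        [|exact Hr|].
      - intros z Hz. apply cdiff_mult; [apply cdiff_const|now apply HF].
      - intros z Hz.
        eapply Rle_trans; [apply Rle_abs|].
        eapply Rle_trans; [apply re_le_Cmod|].
        rewrite Cmod_mult, Cmod_conj. fold m.
        apply Rmult_le_compat_l; [lra|now apply HM]. }
    rewrite Hsq in H. nra.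
Qed.

(** * Moebius maps of the disc and the Schwarz-Pick lemma *)

Definition moebius (a z : C) : C := ((z - a) / (1 - Cconj a * z))%C.

Definition pseudo_dist (a b : C) : R := Cmod (moebius a b).

Lemma one_minus_conj_neq_0 (a z : C) :
  unit_disc a -> Cmod z <= 1 -> (1 - Cconj a * z)%C <> 0.
Proof.
  unfold unit_disc. intros Ha Hz E.
  assert (H : Cmod (Cconj a * z) = 1).
  { replace (Cconj a * z)%C with (1 - (1 - Cconj a * z))%C by ring.
    rewrite E. replace (1 - 0)%C with (RtoC 1) by ring. apply Cmod_1. }
  rewrite Cmod_mult, Cmod_conj in H.
  pose proof (Cmod_ge_0 a). pose proof (Cmod_ge_0 z). nra.
Qed.

Lemma cdiff_one_minus_conj (a z : C) : cdiff (fun w => 1 - Cconj a * w)%C z.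
Proof.
  exists (fun _ => - Cconj a)%C. split; [apply ccont_const|]. intros; ring.
Qed.

Lemma moebius_identity (a z : C) :
  Cmod (1 - Cconj a * z) ^ 2 - Cmod (z - a) ^ 2
  = (1 - Cmod a ^ 2) * (1 - Cmod z ^ 2).
Proof.
  rewrite !Cmod2_alt. destruct a as [p q], z as [x y].
  unfold Cminus, Cplus, Copp, Cmult, Cconj, Re, Im, RtoC; simpl. ring.
Qed.

Lemma moebius_in_disc (a z : C) :
  unit_disc a -> unit_disc z -> unit_disc (moebius a z).
Proof.
  unfold unit_disc, moebius. intros Ha Hz.
  pose proof (one_minus_conj_neq_0 a z Ha (Rlt_le _ _ Hz)) as Hne.
  rewrite Cmod_div by exact Hne.
  pose proof (proj1 (Cmod_gt_0 _) Hne) as Hpos.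
  apply Rlt_div_l; [exact Hpos|].
  pose proof (moebius_identity a z) as Hid.
  pose proof (Cmod_ge_0 a). pose proof (Cmod_ge_0 z).
  assert (0 < (1 - Cmod a ^ 2) * (1 - Cmod z ^ 2))
    by (apply Rmult_lt_0_compat; nra).
  pose proof (Cmod_ge_0 (z - a)). nra.
Qed.

Lemma cdiff_moebius (a z : C) :
  unit_disc a -> unit_disc z -> cdiff (moebius a) z.
Proof.
  intros Ha Hz. apply cdiff_div.
  - apply cdiff_plus; [apply cdiff_id|apply cdiff_const].
  - apply cdiff_one_minus_conj.
  - apply one_minus_conj_neq_0; [exact Ha|apply Rlt_le, Hz].
Qed.

(** By [moebius_identity], [1 - |moebius a z|^2] is at most a multiple of
    [1 - |z|^2], hence tends to [0] at the unit circle. *)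
Lemma moebius_lower_bound (a : C) (rho : R) :
  unit_disc a -> 0 < rho < 1 -> exists r, 0 < r < 1 /\
  forall z, Cmod z = r -> rho * Cmod (1 - Cconj a * z) <= Cmod (z - a).
Proof.
  unfold unit_disc. intros Ha Hrho. pose proof (Cmod_ge_0 a) as Ha0.
  (* The right-hand side of [moebius_identity] is at most [2 k] for
     [|z| = 1 - k], and [|1 - conj a * z| >= 1 - |a|]. *)
  set (k := (1 - rho) * (1 - Cmod a) ^ 2 / 2).
  assert (Hk : 0 < k < 1).
  { unfold k. assert (0 < (1 - Cmod a) ^ 2) by (apply pow_lt; lra).
    assert ((1 - Cmod a) ^ 2 <= 1) by nra. nra. }
  exists (1 - k). split. { lra. } intros z Hz.
  pose proof (moebius_identity a z) as Hid. rewrite Hz in Hid.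
  assert (Hlow : 1 - Cmod a <= Cmod (1 - Cconj a * z)).
  { assert (1 <= Cmod (1 - Cconj a * z) + Cmod (Cconj a * z)).
    { rewrite <- Cmod_1 at 1.
      replace (RtoC 1) with (1 - Cconj a * z + Cconj a * z)%C at 1 by ring.
      apply Cmod_triangle. }
    rewrite Cmod_mult, Cmod_conj, Hz in H. nra. }
  set (D := Cmod (1 - Cconj a * z)) in *. set (N := Cmod (z - a)) in *.
  assert (HN : 0 <= N) by apply Cmod_ge_0.
  assert (H1 : (1 - Cmod a ^ 2) * (1 - (1 - k) ^ 2) <= 2 * k).
  { assert (0 <= 1 - Cmod a ^ 2 <= 1) by nra.
    assert (0 <= 1 - (1 - k) ^ 2 <= 2 * k) by nra. nra. }
  assert (H2 : 2 * k <= (1 - rho) * D ^ 2).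
  { unfold k. assert ((1 - Cmod a) ^ 2 <= D ^ 2) by (apply pow_incr; lra). nra. }
  assert (H3 : (rho * D) ^ 2 <= N ^ 2).
  { assert (0 <= D ^ 2) by apply pow2_ge_0. nra. }
  apply Rnot_lt_le. intros Hlt. nra.
Qed.

Lemma pow_unbounded (x B : R) : 1 < x -> exists n, B < x ^ n.
Proof.
  intros Hx. destruct (Pow_x_infinity x) with (b := B + 1) as [n Hn].
  - rewrite Rabs_pos_eq; lra.
  - exists n. specialize (Hn n (le_n n)).
    rewrite Rabs_pos_eq in Hn by (apply pow_le; lra). lra.
Qed.

(** The Schwarz lemma with the zero at [a] and the evaluation at the center, so
    that the maximum principle is only needed at the center. The quotient [L] of
    [F] by [moebius a] is continuous at [a] but its differentiability there is
    not known without a theorem on removable singularities. The powers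
    [(w - a) * L w ^ n] avoid this: they are differentiable everywhere, with
    slope [L ^ n] at [a]. On a circle where [|moebius a| >= rho] they are bounded
    by [2 / rho ^ n], whence [|a| |L 0|^n <= 2 / rho ^ n]; large [n] gives
    [|L 0| <= 1 / rho], and then [rho] tends to [1]. *)
Lemma schwarz_zero_at (F : C -> C) (a : C) :
  (forall z, unit_disc z -> Cmod (F z) <= 1) ->
  (forall z, unit_disc z -> cdiff F z) ->
  unit_disc a -> F a = 0 -> Cmod (F 0) <= Cmod a.
Proof.
  intros HF HdF Ha HFa. pose proof (Cmod_ge_0 a) as Ha0.
  destruct (Ceq_dec a 0) as [Ez|Hane].
  { subst a. rewrite HFa. lra. }
  assert (Hapos : 0 < Cmod a) by now apply Cmod_gt_0.
  destruct (HdF a Ha) as [q [Hq Hfact]].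
  assert (Hfact' : forall w, F w = (q w * (w - a))%C).
  { intros w. rewrite <- Hfact, HFa. ring. }
  set (L := fun w => (q w * (1 - Cconj a * w))%C).
  assert (HK : forall n w, unit_disc w ->
      cdiff (fun w => (w + - a) * L w ^ n)%C w).
  { intros n w Hw. destruct (Ceq_dec w a) as [->|Hwa].
    - exists (fun w => L w ^ n)%C. split.
      + apply ccont_pow, ccont_mult; [exact Hq|].
        apply cdiff_cont, cdiff_one_minus_conj.
      + intros w. ring.
    - (* Away from [a] the slope [q] is the quotient of [F w] by [w - a]; the
         radius [|w - a|] keeps [a] out of the neighborhood. *)
      apply cdiff_mult.
      { apply cdiff_plus; [apply cdiff_id|apply cdiff_const]. }
      apply cdiff_pow, cdiff_mult; [|apply cdiff_one_minus_conj].
      assert (Hne : (w - a)%C <> 0).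
      { intros E. apply Hwa. replace w with (w - a + a)%C by ring.
        rewrite E. ring. }
      apply (cdiff_ext_loc (fun w => F w / (w + - a))%C q w (Cmod (w - a))).
      + now apply Cmod_gt_0.
      + intros x Hx. rewrite Hfact'. field. intros E.
        replace (x - w)%C with ((x + - a) - (w - a))%C in Hx by ring.
        rewrite E in Hx. replace (0 - (w - a))%C with (- (w - a))%C in Hx by ring.
        rewrite Cmod_opp in Hx. lra.
      + apply cdiff_div; [now apply HdF| |exact Hne].
        apply cdiff_plus; [apply cdiff_id|apply cdiff_const]. }
  (* [L 0 = q 0], so this bounds the quotient at the center. *)
  assert (Hbound : forall rho, 0 < rho < 1 -> rho * Cmod (q 0) <= 1).
  { intros rho Hrho. apply Rnot_lt_le. intros Hlt.
    destruct (moebius_lower_bound a rho Ha Hrho) as [r [Hr Hlow]].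
    destruct (pow_unbounded _ (2 / Cmod a) Hlt) as [n Hn].
    assert (HL : forall z, Cmod z = r -> Cmod (L z) <= / rho).
    { intros z Hz. specialize (Hlow z Hz).
      assert (Hzd : unit_disc z) by (unfold unit_disc; lra).
      pose proof (HF z Hzd) as HFz. rewrite Hfact', Cmod_mult in HFz.
      unfold L. rewrite Cmod_mult.
      apply Rmult_le_reg_l with rho; [lra|].
      rewrite Rinv_r by lra. pose proof (Cmod_ge_0 (q z)). nra. }
    assert (Hc : Cmod ((0 + - a) * L 0 ^ n) <= 2 * (/ rho) ^ n).
    { apply (Cmod_center_le_of_circle (fun w => (w + - a) * L w ^ n)%C r);
        [apply HK|exact Hr|].
      intros z Hz. rewrite Cmod_mult, Cmod_pow.
      apply Rmult_le_compat; [apply Cmod_ge_0|apply pow_le, Cmod_ge_0| |].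
      - eapply Rle_trans; [apply Cmod_triangle|].
        rewrite Cmod_opp. unfold unit_disc in Ha. lra.
      - apply pow_incr. split; [apply Cmod_ge_0|now apply HL]. }
    rewrite Cmod_mult, Cmod_pow in Hc.
    replace (L 0) with (q 0) in Hc by (unfold L; ring).
    replace (0 + - a)%C with (- a)%C in Hc by ring. rewrite Cmod_opp in Hc.
    rewrite Rpow_mult_distr in Hn. rewrite pow_inv in Hc.
    assert (Hrn : 0 < rho ^ n) by (apply pow_lt; lra).
    apply (proj1 (Rlt_div_l 2 _ _ Hapos)) in Hn.
    apply Rmult_le_compat_l with (r := rho ^ n) in Hc; [|lra].
    replace (rho ^ n * (2 * / rho ^ n)) with 2 in Hc by (field; lra).
    nra. }
  assert (Hq0 : Cmod (q 0) <= 1).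
  { apply Rnot_lt_le. intros Hlt.
    (* If [x = |q 0| > 1], then [rho = 2 / (1 + x)] has [rho * x > 1]. *)
    specialize (Hbound (2 / (1 + Cmod (q 0)))).
    assert (X : 0 < 2 / (1 + Cmod (q 0)) < 1).
    { split; [apply Rdiv_lt_0_compat; lra|]. apply Rlt_div_l; lra. }
    specialize (Hbound X).
    replace (2 / (1 + Cmod (q 0)) * Cmod (q 0))
      with ((2 * Cmod (q 0)) / (1 + Cmod (q 0))) in Hbound by (field; lra).
    apply Rle_div_l in Hbound; lra. }
  rewrite Hfact', Cmod_mult. replace (0 - a)%C with (- a)%C by ring.
  rewrite Cmod_opp. nra.
Qed.

Lemma unit_disc_opp (z : C) : unit_disc z -> unit_disc (- z).
Proof. unfold unit_disc. now rewrite Cmod_opp. Qed.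

Lemma moebius_cancel (a z : C) :
  unit_disc a -> unit_disc z -> moebius (- a) (moebius a z) = z.
Proof.
  intros Ha Hz.
  pose proof (one_minus_conj_neq_0 a z Ha (Rlt_le _ _ Hz)) as H1.
  pose proof (one_minus_conj_neq_0 a a Ha (Rlt_le _ _ Ha)) as H2.
  unfold moebius. rewrite Copp_conj. field.
  split; [exact H1|].
  replace (1 - Cconj a * z - - Cconj a * (z - a))%C
    with (1 - Cconj a * a)%C by ring. exact H2.
Qed.

Lemma pseudo_dist_sym (a b : C) :
  unit_disc a -> unit_disc b -> pseudo_dist a b = pseudo_dist b a.
Proof.
  intros Ha Hb. unfold pseudo_dist, moebius.
  rewrite !Cmod_div
    by (apply one_minus_conj_neq_0; [assumption|apply Rlt_le; assumption]).
  f_equal.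
  - rewrite <- Cmod_opp. f_equal. ring.
  - rewrite <- Cmod_conj. f_equal. f_equal.
    rewrite Cminus_conj, Cmult_conj, Cconj_conj, Cmult_comm. f_equal.
    unfold Cconj, RtoC; simpl. f_equal. ring.
Qed.

(** Moebius maps at the source and at the target turn [F] into a map with the
    zero [moebius a b] and with a value of modulus [pseudo_dist (F b) (F a)] at
    the center. *)
Lemma schwarz_pick (F : C -> C) (a b : C) :
  holomorphic_self_map F -> unit_disc a -> unit_disc b ->
  pseudo_dist (F a) (F b) <= pseudo_dist a b.
Proof.
  intros [Hmap Hhol] Ha Hb.
  set (c := moebius a b).
  assert (Hc : unit_disc c) by now apply moebius_in_disc.
  set (T := fun z => moebius (F b) (F (moebius (- a) z))).
  assert (HT : Cmod (T 0) <= Cmod c).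
  { apply schwarz_zero_at; [| |exact Hc|].
    - intros z Hz. apply Rlt_le, moebius_in_disc; [now apply Hmap|].
      apply Hmap, moebius_in_disc; [now apply unit_disc_opp|exact Hz].
    - intros z Hz.
      assert (Hd : unit_disc (moebius (- a) z))
        by (apply moebius_in_disc; [now apply unit_disc_opp|exact Hz]).
      apply (cdiff_comp (moebius (F b)) (fun z => F (moebius (- a) z))).
      + apply (cdiff_comp F (moebius (- a))).
        * apply cdiff_moebius; [now apply unit_disc_opp|exact Hz].
        * now apply cdiff_of_ex_derive, Hhol.
      + apply cdiff_moebius; apply Hmap; assumption.
    - unfold T, c. rewrite moebius_cancel by assumption.
      unfold moebius. unfold Cdiv. ring. }
  unfold T in HT.
  replace (moebius (- a) 0) with a in HT.
  2:{ unfold moebius. field. }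
  fold (pseudo_dist (F a) (F b)).
  rewrite pseudo_dist_sym by now apply Hmap. exact HT.
Qed.

(** Schwarz-Pick for [delta] gives one inequality, for its inverse [gamma] the
    other. *)
Lemma pseudo_dist_of_disc_inverse (gamma delta : C -> C) (a b : C) :
  holomorphic_self_map gamma -> is_disc_inverse gamma delta ->
  unit_disc a -> unit_disc b ->
  pseudo_dist (delta a) (delta b) = pseudo_dist a b.
Proof.
  intros Hg [Hd Hinv] Ha Hb. apply Rle_antisym.
  - now apply schwarz_pick.
  - pose proof (schwarz_pick gamma (delta a) (delta b) Hg
      (proj1 Hd a Ha) (proj1 Hd b Hb)) as H.
    now rewrite (proj2 (Hinv a Ha)), (proj2 (Hinv b Hb)) in H.
Qed.

(** * Limits of distances along iterates *)

Lemma iterate_in_disc (f : C -> C) (n : nat) (z : C) :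
  holomorphic_self_map f -> unit_disc z -> unit_disc (iterate f n z).
Proof.
  intros [Hf _] Hz. induction n as [|n IH]; [exact Hz|]. now apply Hf.
Qed.

Lemma iterate_succ (f : C -> C) (n : nat) (z : C) :
  iterate f (S n) z = iterate f n (f z).
Proof. apply Nat.iter_succ_r. Qed.

Lemma compact_singleton (z : C) : compact_set (fun w : C => w = z).
Proof.
  intros I U _ HU. destruct (HU z eq_refl) as [i Hi].
  exists (cons i nil). intros x ->. exists i. split; [now left|exact Hi].
Qed.

Lemma is_lim_seq_Cmod (e : nat -> R) (u : nat -> C) (l : C) :
  (forall n, Cmod (u n - l) <= e n) -> is_lim_seq e 0 ->
  is_lim_seq (fun n => Cmod (u n)) (Cmod l).
Proof.
  intros Hu He.
  apply (is_lim_seq_le_le (fun n => Cmod l - e n) _ (fun n => Cmod l + e n)).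
  - intros n. specialize (Hu n). split.
    + assert (Cmod l <= Cmod (u n) + Cmod (u n - l)); [|lra].
      replace l with (u n + - (u n - l))%C at 1 by ring.
      eapply Rle_trans; [apply Cmod_triangle|]. rewrite Cmod_opp. lra.
    + replace (u n) with (l + (u n - l))%C at 1 by ring.
      eapply Rle_trans; [apply Cmod_triangle|]. lra.
  - replace (Finite (Cmod l)) with (Finite (Cmod l - 0)) by (f_equal; ring).
    apply is_lim_seq_minus'; [apply is_lim_seq_const|exact He].
  - replace (Finite (Cmod l)) with (Finite (Cmod l + 0)) by (f_equal; ring).
    apply is_lim_seq_plus'; [apply is_lim_seq_const|exact He].
Qed.

(** In the disc, numerator and denominator of [moebius] move by at most the sum
    of the displacements of the two points. *)
Lemma is_lim_seq_pseudo_dist (u v : nat -> C) (l m : C) :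
  (forall n, unit_disc (u n)) -> (forall n, unit_disc (v n)) ->
  unit_disc l -> unit_disc m ->
  is_lim_seq (fun n => Cmod (u n - l)) 0 ->
  is_lim_seq (fun n => Cmod (v n - m)) 0 ->
  is_lim_seq (fun n => pseudo_dist (u n) (v n)) (pseudo_dist l m).
Proof.
  intros Hu Hv Hl Hm Lu Lv.
  assert (He : is_lim_seq (fun n => Cmod (u n - l) + Cmod (v n - m)) 0).
  { replace (Finite 0) with (Finite (0 + 0)) by (f_equal; ring).
    now apply is_lim_seq_plus'. }
  assert (Hden : forall x y, unit_disc x -> unit_disc y ->
      (1 - Cconj x * y)%C <> 0).
  { intros x y Hx Hy. apply one_minus_conj_neq_0; [exact Hx|apply Rlt_le, Hy]. }
  apply is_lim_seq_ext with
    (fun n => Cmod (v n - u n) / Cmod (1 - Cconj (u n) * v n)).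
  { intros n. symmetry. apply Cmod_div, Hden; auto. }
  unfold pseudo_dist, moebius. rewrite Cmod_div by now apply Hden.
  apply is_lim_seq_div'.
  - eapply is_lim_seq_Cmod; [|exact He]. intros n.
    replace (v n - u n - (m - l))%C with (- (u n - l) + (v n - m))%C by ring.
    eapply Rle_trans; [apply Cmod_triangle|]. rewrite Cmod_opp. lra.
  - eapply is_lim_seq_Cmod; [|exact He]. intros n.
    replace (1 - Cconj (u n) * v n - (1 - Cconj l * m))%C
      with (- (Cconj (u n - l) * v n) + - (Cconj l * (v n - m)))%C
      by (rewrite Cminus_conj; ring).
    eapply Rle_trans; [apply Cmod_triangle|].
    rewrite !Cmod_opp, !Cmod_mult, !Cmod_conj.
    pose proof (Cmod_ge_0 (u n - l)). pose proof (Cmod_ge_0 (v n - m)).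
    specialize (Hv n). unfold unit_disc in Hv, Hl. nra.
  - apply Rgt_not_eq, Cmod_gt_0, Hden; assumption.
Qed.

Lemma continuous_artanh (t : R) : 0 <= t < 1 -> continuous artanh t.
Proof.
  intros Ht. apply (@ex_derive_continuous R_AbsRing R_NormedModule).
  unfold artanh. auto_derive. repeat split; try lra.
  apply Rdiv_lt_0_compat; lra.
Qed.

Lemma is_lim_seq_poincare_dist (u v : nat -> C) (l m : C) :
  (forall n, unit_disc (u n)) -> (forall n, unit_disc (v n)) ->
  unit_disc l -> unit_disc m ->
  is_lim_seq (fun n => Cmod (u n - l)) 0 ->
  is_lim_seq (fun n => Cmod (v n - m)) 0 ->
  is_lim_seq (fun n => poincare_dist (u n) (v n)) (poincare_dist l m).
Proof.
  intros Hu Hv Hl Hm Lu Lv.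
  apply (is_lim_seq_continuous artanh (fun n => pseudo_dist (u n) (v n))).
  - apply continuity_pt_filterlim, continuous_artanh.
    split; [apply Cmod_ge_0|]. now apply moebius_in_disc.
  - now apply is_lim_seq_pseudo_dist.
Qed.

Theorem corollary3 :
  forall f h : C -> C,
    holomorphic_self_map f ->
    left_straightening f h ->
    (forall z w : C, unit_disc z -> unit_disc w ->
       is_lim_seq
         (fun n : nat => poincare_dist (iterate f n z) (iterate f n w))
         (Finite (poincare_dist (h z) (h w)))) /\
    (forall z : C, unit_disc z ->
       hyperbolic_step f z = Finite (poincare_dist (h z) (h (f z)))).
Proof.
  intros f h Hf [Hh [gamma [gamma_inv [Haut [Hinv Hcv]]]]].
  assert (Hpt : forall z, unit_disc z ->
      is_lim_seq (fun n => Cmod (gamma_inv n (iterate f n z) - h z)) 0).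
  { intros z Hz. apply is_lim_seq_spec. intros eps.
    destruct (Hcv (fun w => w = z) (compact_singleton z)) with (eps := pos eps)
      as [N HN].
    - now intros w ->.
    - apply cond_pos.
    - exists N. intros n Hn. rewrite Rminus_0_r.
      rewrite Rabs_pos_eq by apply Cmod_ge_0. now apply HN. }
  assert (Hlim : forall z w : C, unit_disc z -> unit_disc w ->
      is_lim_seq (fun n => poincare_dist (iterate f n z) (iterate f n w))
        (poincare_dist (h z) (h w))).
  { intros z w Hz Hw.
    apply is_lim_seq_ext with (fun n =>
      poincare_dist (gamma_inv n (iterate f n z)) (gamma_inv n (iterate f n w))).
    - intros n. apply (f_equal artanh).
      apply (pseudo_dist_of_disc_inverse (gamma n));
        [apply Haut|apply Hinv|now apply iterate_in_disc|now apply iterate_in_disc].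
    - apply is_lim_seq_poincare_dist.
      + intros n. apply (Hinv n). now apply iterate_in_disc.
      + intros n. apply (Hinv n). now apply iterate_in_disc.
      + now apply Hh.
      + now apply Hh.
      + now apply Hpt.
      + now apply Hpt. }
  split; [exact Hlim|]. intros z Hz. apply is_lim_seq_unique.
  apply is_lim_seq_ext with
    (fun n => poincare_dist (iterate f n z) (iterate f n (f z))).
  - intros n. now rewrite iterate_succ.
  - apply Hlim; [exact Hz|]. now apply Hf.
Qed.
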